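(* Let $P,\psi_0,\dot\psi_0,u_0,\dot u_0$ be toric Cauchy data as in the context, let $u_s=u_0+s\dot u_0$ and $\psi(s,x)=\psi_s(x)=u_s^\star(x)=\sup_{y\in P}\big(\langle x,y\rangle-u_0(y)-s\dot u_0(y)\big)$. Let $s>0$, let $y\in A_s\setminus\partial P$, where $A_s:=\{y\in P: u_s(y)\ne u_s^{\star\star}(y)\}$, and let $x:=\nabla u_s^{\star\star}(y)$. Then $$\mathrm{co}\,\big\{(-\dot u_0(v),v): v\in\gamma_x\psi(s,x)\big\}\ \subset\ \partial\psi(s,x)\ \subset\ \mathrm{co}\,\big\{(-\dot u_0(v),v): v\in\partial_x\psi(s,x)\big\}.$$
   Context: Toric Cauchy data. $(M,\omega)$ is a toric Kähler manifold of complex dimension $n$, with Delzant moment polytope $P=\{y\in\mathbb R^n: l_k(y)\ge 0,\ k=1,\dots,d\}$, where $l_k(y)=\langle y,v_k\rangle-\lambda_k$ are the affine functions defining the facets (inward primitive normals $v_k$; exactly $n$ facets meet at each vertex and their normals form a lattice basis). $\psi_0:\mathbb R^n\to\mathbb R$ is the open-orbit Kähler potential, in logarithmic coordinates, of an $(S^1)^n$-invariant Kähler metric in the class of $\omega$: it is smooth with positive definite Hessian, and $\nabla\psi_0$ is a diffeomorphism of $\mathbb R^n$ onto the interior $P\setminus\partial P$. $\dot\psi_0$ is the restriction to the open orbit of a smooth $(S^1)^n$-invariant function on $M$. Set $u_0:=\psi_0^\star$ (Legendre-Fenchel dual, a function on $P$) and $\dot u_0:=-\dot\psi_0\circ(\nabla\psi_0)^{-1}$,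 which extends to an element of $C^\infty(P)$ (smooth up to the boundary). By Guillemin, $u_0=\sum_{k=1}^d l_k\log l_k+F$ with $F\in C^\infty(P)$ (up to the normalization of the $l_k$), and $u_0$ is smooth with positive definite Hessian on the interior of $P$ and on the relative interior of each face. $u_s^{\star\star}$ is the biconjugate of $u_s$, i.e. the largest convex function on $P$ that is $\le u_s$; it is $C^1$ on $P\setminus\partial P$. $\mathrm{co}$ denotes convex hull. $\partial\psi(s,x)\subset\mathbb R\times\mathbb R^n$ is the subdifferential of the convex function $\psi$ of $(s,x)$ (first component dual to $s$); $\partial_x\psi(s,x):=\partial\psi_s(x)\subset\mathbb R^n$ is the subdifferential of $\psi_s=\psi(s,\cdot)$ at $x$. For a convex function $f$ with set of differentiability $\Delta(f)$, the set of reachable subgradients is $\gamma f(x):=\{x^*:\exists\,\{x_k\}_{k\ge1}\subset\Delta(f)\text{ with }\lim_k (x_k,\nabla f(x_k))=(x,x^* )\}$; and $\gamma_x\psi(s,x):=\gamma\psi_s(x)$. *)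

(* Defs.v *)
(* MathComp-Analysis; the scalars are an arbitrary [R : realType]. *)
From HB Require Import structures.
From mathcomp Require Import all_boot all_order all_algebra.
From mathcomp Require Import all_classical all_reals all_analysis.

Set Implicit Arguments.
Unset Strict Implicit.
Unset Printing Implicit Defensive.

Import Order.TTheory GRing.Theory Num.Theory.
Import numFieldNormedType.Exports.

Local Open Scope classical_set_scope.
Local Open Scope ring_scope.

(** * Differential calculus *)

(* Meant for open [U]: f is C^k on U. *)
Fixpoint Ck_on (R : realType) (V W : normedModType R) (U : set V) (k : nat)
    (f : V -> W) : Prop :=
  match k with
  | 0 => forall x, U x -> {for x, continuous f}
  | k'.+1 => (forall x, U x -> differentiable f x) /\
             (forall h : V, Ck_on U k' ('D_h f))
  end.

Definition smooth_on (R : realType) (V W : normedModType R) (U : set V)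
    (f : V -> W) : Prop :=
  forall k, Ck_on U k f.

(* C^oo(P), P closed: only the values of f on P matter. *)
Definition smooth_upto (R : realType) (V W : normedModType R) (P : set V)
    (f : V -> W) : Prop :=
  exists (U : set V) (F : V -> W),
    [/\ open U, P `<=` U, smooth_on U F & forall x, P x -> F x = f x].

Definition dotv (R : realType) (n : nat) (x y : 'rV[R]_n) : R :=
  \sum_j x 0 j * y 0 j.

Definition grad (R : realType) (n : nat) (f : 'rV[R]_n -> R) (x : 'rV[R]_n) :
    'rV[R]_n :=
  \row_j 'D_(delta_mx 0 j) f x.

Definition hessian (R : realType) (n : nat) (f : 'rV[R]_n -> R)
    (x : 'rV[R]_n) : 'M[R]_n :=
  \matrix_(i, j) 'D_(delta_mx 0 i) ('D_(delta_mx 0 j) f) x.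

Definition posdef (R : realType) (n : nat) (A : 'M[R]_n) : Prop :=
  forall h : 'rV[R]_n, h != 0 -> 0 < (h *m A *m h^T) 0 0.

(* C^n is modelled as R^n * R^n, z = a + ib being the pair (a, b). *)
Definition multJ (R : realType) (n : nat) (h : 'rV[R]_n * 'rV[R]_n) :
    'rV[R]_n * 'rV[R]_n :=
  (- h.2, h.1).

(* D^2 f (h, h) + D^2 f (ih, ih) is 4 times the value at h of the Hermitian
   form with coefficients d^2 f / dz_j dzbar_k, so this says that
   i ddbar f is a positive (1,1)-form, i.e. a Kaehler form, on C^n. *)
Definition strictly_psh (R : realType) (n : nat)
    (f : 'rV[R]_n * 'rV[R]_n -> R) : Prop :=
  forall z h : 'rV[R]_n * 'rV[R]_n, h != 0 ->
    0 < 'D_h ('D_h f) z + 'D_(multJ h) ('D_(multJ h) f) z.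

(** * Convex analysis *)

(* Legendre-Fenchel dual of f : D -> R; a real supremum, hence meaningful
   only where the set is bounded above. *)
Definition legendre (R : realType) (n : nat) (D : set 'rV[R]_n)
    (f : 'rV[R]_n -> R) (x : 'rV[R]_n) : R :=
  sup [set dotv x y - f y | y in D].

(* The biconjugate, as a function on D, of f : D -> R. *)
Definition biconjugate (R : realType) (n : nat) (D : set 'rV[R]_n)
    (f : 'rV[R]_n -> R) : 'rV[R]_n -> R :=
  legendre setT (legendre D f).

Definition subdiff (R : realType) (n : nat) (f : 'rV[R]_n -> R)
    (x : 'rV[R]_n) : set 'rV[R]_n :=
  [set p | forall z, f x + dotv p (z - x) <= f z].

(* The first component of a subgradient is dual to s. *)
Definition subdiff_sx (R : realType) (n : nat) (f : R -> 'rV[R]_n -> R)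
    (s : R) (x : 'rV[R]_n) : set (R * 'rV[R]_n) :=
  [set p | forall s' x',
     f s x + (p.1 * (s' - s) + dotv p.2 (x' - x)) <= f s' x'].

Definition reachable_subgrad (R : realType) (n : nat) (f : 'rV[R]_n -> R)
    (x : 'rV[R]_n) : set 'rV[R]_n :=
  [set p | exists xk : nat -> 'rV[R]_n,
     [/\ forall k, differentiable f (xk k),
         xk k @[k --> \oo] --> x &
         grad f (xk k) @[k --> \oo] --> p]].

Definition conv_hull (R : realType) (E : lmodType R) (A : set E) : set E :=
  smallest (@convex_set R E) A.

Definition boundary (T : topologicalType) (A : set T) : set T :=
  closure A `\` interior A.

(** * Delzant polytopes *)

Definition facet_fun (R : realType) (n d : nat) (nu : 'I_d -> 'rV[int]_n)
    (lam : 'I_d -> R) (k : 'I_d) (y : 'rV[R]_n) : R :=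
  dotv y (map_mx intr (nu k)) - lam k.

Definition polytope (R : realType) (n d : nat) (nu : 'I_d -> 'rV[int]_n)
    (lam : 'I_d -> R) : set 'rV[R]_n :=
  [set y | forall k, 0 <= facet_fun nu lam k y].

Definition vertex (R : realType) (n : nat) (P : set 'rV[R]_n)
    (p : 'rV[R]_n) : Prop :=
  P p /\ forall a b (t : R), P a -> P b -> 0 < t < 1 ->
    p = t *: a + (1 - t) *: b -> a = b.

(* sigma lists, without repetition, the facets through p: there are exactly
   n of them. *)
Definition facets_at (R : realType) (n d : nat) (nu : 'I_d -> 'rV[int]_n)
    (lam : 'I_d -> R) (p : 'rV[R]_n) (sigma : 'I_n -> 'I_d) : Prop :=
  injective sigma /\
  forall k, facet_fun nu lam k p = 0 <-> exists i, k = sigma i.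

Definition normals_mx (n d : nat) (nu : 'I_d -> 'rV[int]_n)
    (sigma : 'I_n -> 'I_d) : 'M[int]_n :=
  \matrix_(i, j) nu (sigma i) 0 j.

Record delzant (R : realType) (n d : nat) (nu : 'I_d -> 'rV[int]_n)
    (lam : 'I_d -> R) : Prop := Delzant {
  delzant_compact : compact (polytope nu lam);
  delzant_full : interior (polytope nu lam) !=set0;
  (* the d inequalities define d distinct facets *)
  delzant_facet : forall k, exists y, facet_fun nu lam k y = 0 /\
    forall k', k' != k -> 0 < facet_fun nu lam k' y;
  delzant_primitive : forall k (m : nat) (w : 'rV[int]_n),
    nu k = m%:Z *: w -> m = 1%N;
  (* invertibility over the integers: the normals form a basis of Z^n *)
  delzant_vertex : forall p, vertex (polytope nu lam) p ->
    exists2 sigma : 'I_n -> 'I_d, facets_at nu lam p sigma &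
      normals_mx nu sigma \in unitmx }.

(** * Toric Cauchy data *)

(* The toric manifold M of a Delzant polytope is covered by one chart C^n for
   each vertex p.  If e_1, ..., e_n is the basis of Z^n dual to the normals of
   the facets through p, then the point of the open orbit with logarithmic
   coordinates x (x_j = log |w_j|^2, w being its coordinates in the complex
   torus) has coordinates z in that chart with |z_j|^2 = exp <e_j, x>; the
   arguments are arbitrary, which accounts for torus invariance below.  The
   e_j are the columns of [invmx (normals_mx nu sigma)]. *)
Definition in_chart (R : realType) (n d : nat) (nu : 'I_d -> 'rV[int]_n)
    (sigma : 'I_n -> 'I_d) (x : 'rV[R]_n) (z : 'rV[R]_n * 'rV[R]_n) : Prop :=
  forall j, z.1 0 j ^+ 2 + z.2 0 j ^+ 2 =
    expR ((x *m map_mx intr (invmx (normals_mx nu sigma))) 0 j).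

(* f is the restriction to the open orbit of an (S^1)^n-invariant smooth
   function on M. *)
Definition toric_smooth (R : realType) (n d : nat) (nu : 'I_d -> 'rV[int]_n)
    (lam : 'I_d -> R) (f : 'rV[R]_n -> R) : Prop :=
  forall p sigma, vertex (polytope nu lam) p -> facets_at nu lam p sigma ->
  exists2 g : 'rV[R]_n * 'rV[R]_n -> R, smooth_on setT g &
    forall x z, in_chart nu sigma x z -> f x = g z.

(* psi is an open-orbit potential of an (S^1)^n-invariant Kaehler metric on M:
   in the chart at the vertex p the metric is i ddbar phi.  As <p, x> is
   pluriharmonic on the open orbit, i ddbar psi is the same form there.  That
   <p, x> is subtracted at each vertex p says that the metric lies in the
   Kaehler class determined by the polytope. *)
Definition toric_kaehler_potential (R : realType) (n d : nat)
    (nu : 'I_d -> 'rV[int]_n) (lam : 'I_d -> R) (psi : 'rV[R]_n -> R) : Prop :=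
  forall p sigma, vertex (polytope nu lam) p -> facets_at nu lam p sigma ->
  exists phi : 'rV[R]_n * 'rV[R]_n -> R,
    [/\ smooth_on setT phi, strictly_psh phi &
        forall x z, in_chart nu sigma x z -> psi x = dotv p x + phi z].

(* [du0] is the smooth extension to the polytope of
   - dpsi0 \o (grad psi0)^-1; its values off the polytope are irrelevant. *)
Record toric_cauchy_data (R : realType) (n d : nat)
    (nu : 'I_d -> 'rV[int]_n) (lam : 'I_d -> R)
    (psi0 dpsi0 du0 : 'rV[R]_n -> R) : Prop := ToricCauchyData {
  tcd_delzant : delzant nu lam;
  tcd_kaehler : toric_kaehler_potential nu lam psi0;
  tcd_smooth : smooth_on setT psi0;
  tcd_hessian : forall x, posdef (hessian psi0 x);
  tcd_diffeo : exists g : 'rV[R]_n -> 'rV[R]_n,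
    [/\ smooth_on (interior (polytope nu lam)) g,
        forall x, interior (polytope nu lam) (grad psi0 x),
        forall x, g (grad psi0 x) = x &
        forall y, interior (polytope nu lam) y -> grad psi0 (g y) = y];
  tcd_dpsi0 : toric_smooth nu lam dpsi0;
  tcd_du0_smooth : smooth_upto (polytope nu lam) du0;
  tcd_du0 : forall x, du0 (grad psi0 x) = - dpsi0 x }.

(* Main.v *)
(* For v in P set k(v) = (- du0 v, v).  Then psi is a supremum of affine
   functions of (s, x) indexed by the compact set P, the one of index v having
   slope k(v) and a constant term that is upper semicontinuous in v.  By
   Danskin's argument, the subdifferential of psi at (s, x) is the convex hull
   of the k(v), v in the set of maximizers at (s, x); a maximizer is a
   subgradient of psi_s, and a reachable subgradient is a limit of gradients,
   i.e. of unique maximizers, hence a maximizer.  The geometry only serves to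
   show that u0 is finite on the whole of P: psi0 - <p, .> is bounded below for
   each vertex p, since it extends continuously to the fixed point p and is
   convex along rays converging to it, and P is the convex hull of its
   vertices. *)
Require Import Defs.
From HB Require Import structures.
From mathcomp Require Import all_boot all_order all_algebra.
From mathcomp Require Import all_classical all_reals all_analysis.
From mathcomp Require Import ring lra.

Import Order.TTheory GRing.Theory Num.Theory.
Import numFieldNormedType.Exports.

Local Open Scope classical_set_scope.
Local Open Scope ring_scope.

Set Implicit Arguments.
Unset Strict Implicit.
Unset Printing Implicit Defensive.

(** * The Euclidean pairing: bilinearity, positivity, continuity *)

Section Dotv.
Context {R : realType} {n : nat}.
Implicit Types x y z : 'rV[R]_n.

Lemma dotvC x y : dotv x y = dotv y x.
Proof. by apply: eq_bigr => j _; rewrite mulrC. Qed.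

Lemma dotvDl x y z : dotv (x + y) z = dotv x z + dotv y z.
Proof. by rewrite -big_split; apply: eq_bigr => j _; rewrite mxE mulrDl. Qed.

Lemma dotvZl a x y : dotv (a *: x) y = a * dotv x y.
Proof. by rewrite mulr_sumr; apply: eq_bigr => j _; rewrite mxE mulrA. Qed.

Lemma dotvNl x y : dotv (- x) y = - dotv x y.
Proof. by rewrite -scaleN1r dotvZl mulN1r. Qed.

Lemma dotvBl x y z : dotv (x - y) z = dotv x z - dotv y z.
Proof. by rewrite dotvDl dotvNl. Qed.

Lemma dotvDr x y z : dotv x (y + z) = dotv x y + dotv x z.
Proof. by rewrite dotvC dotvDl !(dotvC x). Qed.

Lemma dotvZr a x y : dotv x (a *: y) = a * dotv x y.
Proof. by rewrite dotvC dotvZl dotvC. Qed.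

Lemma dotvNr x y : dotv x (- y) = - dotv x y.
Proof. by rewrite dotvC dotvNl dotvC. Qed.

Lemma dotvBr x y z : dotv x (y - z) = dotv x y - dotv x z.
Proof. by rewrite dotvDr dotvNr. Qed.

Lemma dotv0r x : dotv x 0 = 0.
Proof. by rewrite -(scale0r 0) dotvZr mul0r. Qed.

Lemma dotv_sqrB x y : dotv (x - y) (x - y) = dotv x x - 2 * dotv y x + dotv y y.
Proof. by rewrite dotvBl !dotvBr (dotvC x y); ring. Qed.

Lemma dotv_delta x j : dotv x (delta_mx 0 j) = x 0 j.
Proof.
rewrite /dotv (bigD1 j)//= mxE !eqxx mulr1 big1 ?addr0// => i /negPf ij.
by rewrite mxE ij andbF mulr0.
Qed.

Lemma dotv_sqr_ge0 x : 0 <= dotv x x.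
Proof. by apply: sumr_ge0 => j _; rewrite -expr2 sqr_ge0. Qed.

Lemma dotv_sqr_eq0 x : dotv x x = 0 -> x = 0.
Proof.
move=> /eqP; rewrite psumr_eq0 => [/allP xx0|j _]; last by rewrite -expr2 sqr_ge0.
apply/rowP => j; rewrite mxE; apply/eqP.
by have := xx0 j (mem_index_enum j); rewrite mulf_eq0 orbb.
Qed.

Lemma cvg_dotv (T : Type) (F : set_system T) (FF : Filter F)
    (f g : T -> 'rV[R]_n) x y :
  f @ F --> x -> g @ F --> y -> dotv (f t) (g t) @[t --> F] --> dotv x y.
Proof.
move=> fx gy; apply: cvg_big => [|j _]; first exact: add_continuous.
apply: cvgM.
- exact: (cvg_comp _ _ fx (@coord_continuous _ _ _ 0 j x)).
- exact: (cvg_comp _ _ gy (@coord_continuous _ _ _ 0 j y)).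
Qed.

Lemma continuous_dotvr x : continuous (dotv x).
Proof.
move=> y.
exact: (@cvg_dotv _ (nbhs y) _ (cst x) id x y (cvg_cst _) cvg_id).
Qed.

End Dotv.

(** * Convex sets and hulls in terms of real scalars *)

Section Convex_sets.
Context {R : realType} {E : lmodType R}.

Lemma convex_setE (A : set E) :
  @convex_set R E A <->
  forall x y t, 0 <= t <= 1 -> A x -> A y -> A (t *: x + (1 - t) *: y).
Proof.
split=> cA.
- move=> x y t /andP[t0 t1] Ax Ay.
  by have := cA x y (Itv01 t0 t1); rewrite !inE; exact.
- move=> x y t; rewrite !inE => Ax Ay; apply: cA => //.
  by apply/andP; split; [exact: ge0|exact: le1].
Qed.

Lemma convex_conv_hull (A : set E) x y t : 0 <= t <= 1 ->
  conv_hull A x -> conv_hull A y -> conv_hull A (t *: x + (1 - t) *: y).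
Proof.
move=> t01 hx hy B [cB AB]; apply: (convex_setE B).1 => //.
- exact: hx.
- exact: hy.
Qed.

End Convex_sets.

(** * Caratheodory's theorem and convex hulls of compact sets *)

(** The entries lie in any topological space because the lemma is applied to row vectors whose
    entries are themselves points of ['rV[R]_N]. *)
Lemma mx_coord_continuous (T : topologicalType) m n i j :
  continuous (fun M : 'M[T]_(m, n) => M i j).
Proof.
move=> M A MA; exists (fun i' j' => if (i' == i) && (j' == j) then A else setT).
  move=> i' j'; case: ifPn => [/andP[/eqP-> /eqP->]//|_]; exact: filterT.
by move=> N /(_ i j); rewrite /= !eqxx.
Qed.

Lemma cvg_mx (T : topologicalType) m n (I : Type) (F : set_system I)
    (FF : Filter F) (f : I -> 'M[T]_(m, n)) (M : 'M[T]_(m, n)) :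
  (forall i j, f t i j @[t --> F] --> M i j) -> f @ F --> M.
Proof.
move=> fM A [P MP sPA].
apply: (@filterS _ F FF [set t | forall i j, P i j (f t i j)]).
  by move=> t Pt; exact: sPA.
apply: (@filter_forall _ _ (fun i => [set t | forall j, P i j (f t i j)])) => i.
by apply: (@filter_forall _ _ (fun j => [set t | P i j (f t i j)])) => j; exact: fM.
Qed.

Section Caratheodory.
Context {R : realType} {N : nat}.
Implicit Types (K : set 'rV[R]_N) (m : nat).

Definition convex_combs K m : set 'rV[R]_N :=
  [set p | exists (w : 'I_m -> R) (v : 'I_m -> 'rV[R]_N),
     [/\ forall i, 0 <= w i, \sum_i w i = 1, forall i, K (v i) &
         p = \sum_i w i *: v i]].

(** Pad with an extra point of weight 0, a repetition of the first one. For [m = 0] there is nothing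
    to pad: an empty sum of weights is not 1. *)
Lemma convex_combsS K m : convex_combs K m `<=` convex_combs K m.+1.
Proof.
case: m => [|m] p [w [v [w0 w1 Kv ->]]].
  by move: w1; rewrite big_ord0 => /eqP; rewrite eq_sym oner_eq0.
pose ext T (a : T) (f : 'I_m.+1 -> T) (i : 'I_m.+2) :=
  if unlift ord0 i is Some j then f j else a.
exists (ext _ 0 w), (ext _ (v ord0) v); rewrite /ext; split.
- by move=> i; case: (unlift ord0 i).
- rewrite big_ord_recl unlift_none add0r -w1.
  by apply: eq_bigr => i _; rewrite liftK.
- by move=> i; case: (unlift ord0 i).
- rewrite [RHS]big_ord_recl unlift_none scale0r add0r.
  by apply: eq_bigr => i _; rewrite liftK.
Qed.

Lemma convex_combs_mono K m m' : (m <= m')%N ->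
  convex_combs K m `<=` convex_combs K m'.
Proof.
move=> /subnK <-; elim: (m' - m)%N => // k IH.
by rewrite addSn; exact: subset_trans IH (@convex_combsS _ _).
Qed.

(** The matrix with rows [(1, v i)] has rank at most [N.+1 < m], so it has a nonzero left kernel
    vector, whose entries are the coefficients. *)
Lemma affine_dependence m (v : 'I_m -> 'rV[R]_N) : (N.+1 < m)%N ->
  exists c : 'I_m -> R, [/\ exists i, 0 < c i, \sum_i c i = 0 &
    \sum_i c i *: v i = 0].
Proof.
move=> Nm; pose M : 'M[R]_(m, 1 + N) := row_mx (const_mx 1) (\matrix_i v i).
have kerM : kermx M != 0.
  rewrite -mxrank_eq0 mxrank_ker subn_eq0 -ltnNge.
  exact: leq_ltn_trans (rank_leq_col M) Nm.
have [i ui0] : exists i, row i (kermx M) != 0.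
  apply/existsP; apply: contraNT kerM => /existsPn r0.
  by apply/eqP/row_matrixP => i; rewrite row0; apply/eqP/negPn/r0.
set u := row i _ in ui0.
have : u *m M = 0 by rewrite -row_mul mulmx_ker row0.
rewrite mul_mx_row -row_mx0 => /eq_row_mx[uM1 uMv].
have u1 : \sum_j u 0 j = 0.
  move/matrixP/(_ 0 0): uM1; rewrite !mxE => uM1; rewrite -[RHS]uM1.
  by apply: eq_bigr => j _; rewrite [const_mx _ _ _]mxE mulr1.
have uv : \sum_j u 0 j *: v j = 0.
  by rewrite -[RHS]uMv mulmx_sum_row; apply: eq_bigr => j _; rewrite rowK.
exists (u 0); split=> //.
(* Nonpositive coefficients with sum 0 would all vanish. *)
apply: contrapT => /forallNP u_le0.
move/negP: ui0; apply; apply/eqP/rowP => j; rewrite [RHS]mxE.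
have le0 k : u 0 k <= 0 by rewrite leNgt; apply/negP.
have /eqP : \sum_j - u 0 j = 0 by rewrite sumrN u1 oppr0.
rewrite psumr_eq0 => [/allP/(_ j)|k _]; last by rewrite oppr_ge0.
by rewrite mem_index_enum oppr_eq0 => /(_ isT)/eqP.
Qed.

(** Subtract from the weights the largest multiple [r] of an affine dependence that keeps them
    nonnegative; the weight attaining the minimal ratio becomes 0 and its point is dropped. *)
Lemma convex_combs_pred K m : (N < m)%N ->
  convex_combs K m.+1 `<=` convex_combs K m.
Proof.
move=> Nm p [w [v [w0 w1 Kv ->]]].
have [c [[i1 ci1] c0 cv]] := affine_dependence v (Nm : (N.+1 < m.+1)%N).
have [i ci imin] : exists2 i, 0 < c i &
    forall j, 0 < c j -> w i / c i <= w j / c j.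
  by case: (@Order.TotalTheory.arg_minP _ _ _ i1 (fun j => 0 < c j)
    (fun j => w j / c j) ci1) => i ci imin; exists i.
pose r := w i / c i.
have r0 : 0 <= r by rewrite divr_ge0// ltW.
pose w' j := w j - r * c j.
have w'i : w' i = 0 by rewrite /w' /r divfK ?subrr// gt_eqF.
have w'0 j : 0 <= w' j.
  rewrite subr_ge0; have [cj|cj] := ltP 0 (c j).
    by rewrite -ler_pdivlMr//; exact: imin.
  by apply: le_trans (w0 j); rewrite mulr_ge0_le0.
have w'1 : \sum_j w' j = 1 by rewrite sumrB w1 -mulr_sumr c0 mulr0 subr0.
have w'v : \sum_j w' j *: v j = \sum_j w j *: v j.
  under eq_bigr do rewrite scalerBl -scalerA.
  by rewrite sumrB -scaler_sumr cv scaler0 subr0.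
exists (w' \o lift i), (v \o lift i); split => //=.
- by move: w'1; rewrite (bigD1_ord i)//= w'i add0r.
- by rewrite -w'v (bigD1_ord i)//= w'i scale0r add0r.
Qed.

Lemma convex_combs_caratheodory K m : convex_combs K m `<=` convex_combs K N.+1.
Proof.
have [mN|] := leqP m N.+1; first exact: convex_combs_mono.
move=> /ltnW/subnK <-; elim: (m - N.+1)%N => // k IH.
rewrite addSn; apply: subset_trans (convex_combs_pred _) IH.
by rewrite leq_addl.
Qed.

Lemma convex_combs_conv K m : convex_combs K m `<=` conv_hull K.
Proof.
elim: m => [|m IH] p [w [v [w0 w1 Kv ->]]].
  by move: w1; rewrite big_ord0 => /eqP; rewrite eq_sym oner_eq0.
have Kconv i : conv_hull K (v i) by exact: sub_gen_smallest (Kv i).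
rewrite big_ord_recl; move: w1; rewrite big_ord_recl => w1.
set W := \sum_(i < m) _ in w1.
have W0 : 0 <= W by exact: sumr_ge0.
(* The induction hypothesis needs the remaining weights divided by their total [W]; if [W = 0], only
   the first point is left. *)
have [WE|Wn0] := eqVneq W 0.
  have w'0 i : w (lift ord0 i) = 0.
    move/eqP: WE; rewrite psumr_eq0// => /allP/(_ i).
    by rewrite mem_index_enum => /(_ isT)/eqP.
  rewrite big1 => [|i _]; last by rewrite w'0 scale0r.
  by move: w1; rewrite WE !addr0 => ->; rewrite scale1r.
have -> : \sum_(i < m) w (lift ord0 i) *: v (lift ord0 i) =
    (1 - w ord0) *: (\sum_(i < m) (W^-1 * w (lift ord0 i)) *: v (lift ord0 i)).
  have -> : 1 - w ord0 = W by rewrite -w1 addrC addKr.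
  by rewrite scaler_sumr; apply: eq_bigr => i _; rewrite scalerA mulVKf.
apply: convex_conv_hull => //.
  by rewrite w0 -w1 lerDl.
apply: IH; exists (fun i => W^-1 * w (lift ord0 i)), (v \o lift ord0).
split=> // [i||i]; last exact: Kv.
  by rewrite mulr_ge0// invr_ge0.
by rewrite -mulr_sumr mulVf.
Qed.

(** Mixing two combinations of [N.+1] points gives one of twice as many, which Caratheodory
    reduction brings back to [N.+1]; so these combinations form a convex set. *)
Lemma conv_hull_combs K : conv_hull K = convex_combs K N.+1.
Proof.
apply/seteqP; split; last exact: convex_combs_conv.
apply: smallest_sub => [|v Kv]; last first.
  apply: (@convex_combs_mono _ 1) => //; exists (fun=> 1), (fun=> v).
  by split=> //; rewrite big_ord1// scale1r.
apply/convex_setE => x y t /andP[t0 t1].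
move=> [w [v [w0 w1 Kv ->]]] [w' [v' [w'0 w'1 Kv' ->]]].
apply: (@convex_combs_caratheodory _ (N.+1 + N.+1)).
pose glue T (f g : 'I_N.+1 -> T) (i : 'I_(N.+1 + N.+1)) :=
  match fintype.split i with inl j => f j | inr j => g j end.
have glueL T f g i : glue T f g (lshift N.+1 i) = f i.
  by rewrite /glue (unsplitK (inl _ i)).
have glueR T f g i : glue T f g (rshift N.+1 i) = g i.
  by rewrite /glue (unsplitK (inr _ i)).
exists (glue _ (fun i => t * w i) (fun i => (1 - t) * w' i)), (glue _ v v').
split.
- by move=> i; rewrite /glue; case: fintype.split => j; rewrite mulr_ge0// subr_ge0.
- rewrite big_split_ord/=.
  under eq_bigr do rewrite glueL.
  under [X in _ + X]eq_bigr do rewrite glueR.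
  by rewrite -!mulr_sumr w1 w'1 !mulr1 addrC subrK.
- by move=> i; rewrite /glue; case: fintype.split => j.
- rewrite [RHS]big_split_ord/= !scaler_sumr.
  by congr (_ + _); apply: eq_bigr => i _; rewrite ?glueL ?glueR scalerA.
Qed.

(** The hull is the continuous image of the standard simplex times [N.+1] copies of [K]. *)
Lemma compact_conv_hull K : compact K -> compact (conv_hull K).
Proof.
move=> cK; rewrite conv_hull_combs.
pose D : set ('rV[R]_N.+1 * 'rV['rV[R]_N]_N.+1) :=
  [set w : 'rV[R]_N.+1 | (forall i, `[0, 1]%classic (w 0 i)) /\ \sum_i w 0 i = 1]
    `*` [set v : 'rV['rV[R]_N]_N.+1 | forall i, K (v 0 i)].
have -> : convex_combs K N.+1 =
    (fun wv : 'rV[R]_N.+1 * 'rV['rV[R]_N]_N.+1 =>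
       \sum_i wv.1 0 i *: wv.2 0 i) @` D.
  apply/seteqP; split=> p.
    move=> [w [v [w0 w1 Kv ->]]].
    exists (\row_i w i, \row_i v i); last by apply: eq_bigr => i _; rewrite !mxE.
    split=> [|i]/=; last by rewrite mxE.
    split=> [i|]; last by under eq_bigr do rewrite mxE.
    rewrite mxE /= in_itv/= w0/= -w1 (bigD1 i)//= lerDl.
    by rewrite sumr_ge0.
  move=> [[w v] [/= [w0 w1] Kv] <-]; exists (w 0), (v 0); split=> // i.
  by have := w0 i; rewrite /= in_itv/= => /andP[].
apply: continuous_compact.
  apply: continuous_subspaceT => -[w v]; apply: cvg_big => [|i _].
    exact: add_continuous.
  apply: cvgZ.
  - apply: (@continuous_comp _ _ _ fst (fun w : 'rV[R]_N.+1 => w 0 i)).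
      exact: cvg_fst.
    exact: mx_coord_continuous.
  - apply: (@continuous_comp _ _ _ snd (fun v : 'rV['rV[R]_N]_N.+1 => v 0 i)).
      exact: cvg_snd.
    exact: mx_coord_continuous.
apply: compact_setX; last exact: (@rV_compact _ _ (fun=> K)).
apply: compact_closedI.
  exact: (@rV_compact R _ (fun=> `[0, 1]%classic) (fun=> @segment_compact R 0 1)).
have sum_cont : continuous (fun w : 'rV[R]_N.+1 => \sum_i w 0 i).
  move=> w; apply: (@cvg_big _ _ _ _ _ _ _ (nbhs w) _ (fun i u => u 0 i)).
    exact: add_continuous.
  by move=> i _; exact: mx_coord_continuous.
exact: (closed_comp (fun w _ => sum_cont w) (@closed_eq _ 1)).
Qed.

End Caratheodory.

(** * Separation and semicontinuous maximization *)

Section Separation.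
Context {R : realType} {N : nat}.

(* The normal is [p - q] with [q] the point of [C] nearest to [p]. *)
Lemma compact_convex_separation (C : set 'rV[R]_N) (p : 'rV[R]_N) :
  compact C -> @convex_set R _ C -> C !=set0 -> ~ C p ->
  exists l, forall c, C c -> dotv l c < dotv l p.
Proof.
move=> cptC /convex_setE cvxC C0 nCp.
pose f (c : 'rV[R]_N) := dotv (c - p) (c - p).
have fcont : continuous f.
  move=> c; have cp : (b - p) @[b --> c] --> c - p.
    exact: (@cvgB _ _ _ (nbhs c) _ id (cst p) c p cvg_id (cvg_cst _)).
  exact: (cvg_dotv _ cp cp).
have [q /set_mem Cq qmin] := compact_EVT_min C0 cptC (continuous_subspaceT fcont).
exists (p - q) => c Cc; set l := p - q.
have l0 : 0 < dotv l l.
  rewrite lt_neqAle dotv_sqr_ge0 andbT eq_sym; apply/eqP => /dotv_sqr_eq0/eqP.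
  by rewrite subr_eq0 => /eqP pq; apply: nCp; rewrite pq.
suff lcq : dotv l (c - q) <= 0.
  rewrite -subr_gt0 -dotvBr.
  have -> : p - c = l - (c - q) by rewrite /l opprB addrA subrK.
  by rewrite dotvBr; lra.
rewrite leNgt; apply/negP => a0.
set a := dotv l (c - q) in a0; pose B := dotv (c - q) (c - q).
have B0 : 0 <= B by exact: dotv_sqr_ge0.
have aB : 0 < a + B by lra.
(* The squared distance from [p] to [q + t (c - q)] is [t^2 B - 2 t a + dotv l l]. This [t] lies in
   (0, 1] and satisfies [t B < 2 a], so that point of [C] would be nearer to [p] than [q]. *)
pose t := a / (a + B).
have t0 : 0 < t by rewrite divr_gt0.
have t1 : t <= 1 by rewrite ler_pdivrMr// mul1r; lra.
have tE : t * (a + B) = a by rewrite divfK// gt_eqF.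
have Cz : C (t *: c + (1 - t) *: q) by apply: cvxC => //; rewrite t1 ltW.
have := qmin _ (mem_set Cz); rewrite /f.
have -> : t *: c + (1 - t) *: q - p = t *: (c - q) - l.
  by rewrite scalerBl scalerBr scale1r /l opprB; apply/rowP => j; rewrite !mxE; ring.
have -> : q - p = - l by rewrite opprB.
rewrite dotv_sqrB dotvNl dotvNr opprK dotvZl !dotvZr -/a -/B.
by nra.
Qed.

End Separation.

Section Usc.
Context {R : realType} {T : topologicalType}.
Implicit Types (K : set T) (f g : T -> R).

Definition usc_on K f := forall v, K v -> forall c, f v < c ->
  \forall w \near v, K w -> f w < c.

Lemma usc_on_subset K L f : L `<=` K -> usc_on K f -> usc_on L f.
Proof.
move=> LK uf v Lv c fc; apply: filterS (uf v (LK _ Lv) c fc) => w fw Lw.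
exact/fw/LK.
Qed.

Lemma usc_onD K f g : usc_on K f -> usc_on K g -> usc_on K (fun v => f v + g v).
Proof.
move=> uf ug v Kv c fgc; pose e := (c - f v - g v) / 2.
have fe : f v < f v + e by rewrite /e; lra.
have ge : g v < g v + e by rewrite /e; lra.
apply: filterS2 (uf _ Kv _ fe) (ug _ Kv _ ge) => w nf ng Kw.
by have := nf Kw; have := ng Kw; rewrite /e; lra.
Qed.

Lemma continuous_usc_on K f : {within K, continuous f} -> usc_on K f.
Proof.
move=> fcont v Kv c fc.
have : nbhs (v : subspace K) [set w | f w < c].
  exact: (fcont v [set r | r < c] (lt_nbhsl fc)).
move=> /(nbhs_subspace_ex _ Kv)[V nV VK]; apply: filterS nV => w Vw Kw.
have : (V `&` K) w by [].
by rewrite -VK => -[].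
Qed.

Lemma compact_usc_superlevel K f c : compact K -> usc_on K f ->
  compact [set v | K v /\ c <= f v].
Proof.
move=> cK uf F PF FK.
have FKK : F K by apply: filterS FK => v [].
have [v [Kv clv]] := cK F PF FKK; exists v; split=> //; split=> //.
rewrite leNgt; apply/negP => fvc.
have [w [[Kw cfw] fw]] := clv _ _ FK (uf v Kv c fvc).
by have := fw Kw; rewrite ltNge cfw.
Qed.

(** The superlevel sets of [f] at its values on [K] generate a proper filter; by semicontinuity any
    cluster point of it is a maximizer. *)
Lemma compact_usc_max K f : compact K -> K !=set0 -> usc_on K f ->
  exists2 v, K v & forall w, K w -> f w <= f v.
Proof.
move=> cK [v0 Kv0] uf.
pose F := filter_from K (fun w => [set v | K v /\ f w <= f v]).
have PF : ProperFilter F.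
  apply: filter_from_proper; last by move=> w Kw; exists w.
  apply: filter_from_filter; first by exists v0.
  move=> w w' Kw Kw'; exists (if f w <= f w' then w' else w).
    by case: ifP.
  move=> v; case: leP => [ww' [Kv w'v]|ww' [Kv wv]]; split; split=> //.
    exact: le_trans w'v.
  exact: le_trans (ltW ww') wv.
have FK : F K by exists v0 => // v [].
have [v [Kv clv]] := cK F PF FK; exists v => // w Kw.
rewrite leNgt; apply/negP => fvw.
have Fw : F [set v | K v /\ f w <= f v] by exists w.
have [u [[Ku fwu] fu]] := clv _ _ Fw (uf v Kv _ fvw).
by have := fu Ku; rewrite ltNge fwu.
Qed.

End Usc.

(** * Maximizers in the Legendre transform *)

Section Argmax.
Context {R : realType} {n : nat}.
Implicit Types (P : set 'rV[R]_n) (f : 'rV[R]_n -> R) (x v : 'rV[R]_n).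

Definition legendre_argmax P f x : set 'rV[R]_n :=
  [set v | P v /\ forall w, P w -> dotv x w - f w <= dotv x v - f v].

Lemma legendre_argmaxE P f x v : legendre_argmax P f x v ->
  legendre P f x = dotv x v - f v.
Proof.
move=> [Pv vmax]; apply/eqP; rewrite eq_le; apply/andP; split.
  by apply: ge_sup => [|_ [w Pw <-]]; [exists (dotv x v - f v), v|exact: vmax].
apply: ub_le_sup; last by exists v.
by exists (dotv x v - f v) => _ [w Pw <-]; exact: vmax.
Qed.

Lemma usc_affine_sub P f x : usc_on P (\- f) ->
  usc_on P (fun v => dotv x v - f v).
Proof.
apply: usc_onD; apply: continuous_usc_on.
exact/continuous_subspaceT/continuous_dotvr.
Qed.

Lemma legendre_argmax_exists P f x : compact P -> P !=set0 ->
  usc_on P (\- f) -> exists v, legendre_argmax P f x v.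
Proof.
move=> cP P0 uf.
have [v Pv vmax] := compact_usc_max cP P0 (@usc_affine_sub P f x uf).
by exists v.
Qed.

Lemma legendre_argmax_ge P f v z : compact P -> P !=set0 ->
  usc_on P (\- f) -> P v -> dotv z v - f v <= legendre P f z.
Proof.
move=> cP P0 uf Pv; have [w zw] := legendre_argmax_exists z cP P0 uf.
by rewrite (legendre_argmaxE zw); apply: zw.2.
Qed.

(** The affine function [z |-> dotv z v - f v] lies below the transform and touches it at [x]. *)
Lemma legendre_argmax_subdiff P f x v : compact P -> P !=set0 ->
  usc_on P (\- f) -> legendre_argmax P f x v -> subdiff (legendre P f) x v.
Proof.
move=> cP P0 uf xv z.
rewrite (legendre_argmaxE xv).
by have := legendre_argmax_ge z cP P0 uf xv.1; rewrite dotvBr !(dotvC v); lra.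
Qed.

Lemma subdiff_grad f x p : differentiable f x -> subdiff f x p -> grad f x = p.
Proof.
move=> df xp; apply/rowP => j; rewrite mxE; set e := delta_mx 0 j.
pose q t := t^-1 *: ((f \o shift x) (t *: e) - f x).
have qcvg : q t @[t --> 0^'] --> 'D_e f x by exact: diff_derivable.
have qp t : t * p 0 j <= f (t *: e + x) - f x.
  by have := xp (t *: e + x); rewrite addrK dotvZr dotv_delta; lra.
apply/eqP; rewrite eq_le !leNgt; apply/andP; split; apply/negP => Dp.
(* By [qp], the quotient [q t] is at most [p 0 j] for [t < 0] and at least [p 0 j] for [t > 0];
   [- (r / 2)] and [r / 2] serve as test points close to 0. *)
- have [r /= r0 qr] := qcvg _ (lt_nbhsr Dp).
  have r2 : 0 < r / 2 by rewrite divr_gt0.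
  have := qr (- (r / 2)); rewrite /= sub0r opprK ger0_norm ?ltW//.
  have rr : r / 2 < r by lra.
  rewrite oppr_eq0 gt_eqF// => /(_ rr isT); rewrite /q /= -[_ *: _]mulrC.
  rewrite invrN mulrN ltrNr ltr_pdivrMr//.
  by have := qp (- (r / 2)); lra.
- have [r /= r0 qr] := qcvg _ (lt_nbhsl Dp).
  have r2 : 0 < r / 2 by rewrite divr_gt0.
  have := qr (r / 2); rewrite /= sub0r normrN ger0_norm ?ltW//.
  have rr : r / 2 < r by lra.
  rewrite gt_eqF// => /(_ rr isT); rewrite /q /= -[_ *: _]mulrC.
  rewrite ltr_pdivrMr//.
  by have := qp (r / 2); lra.
Qed.

(** The maximizer relation has a closed graph. *)
Lemma legendre_argmax_closed P f (xk vk : nat -> 'rV[R]_n) x v :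
  compact P -> usc_on P (\- f) ->
  (forall k, legendre_argmax P f (xk k) (vk k)) ->
  xk k @[k --> \oo] --> x -> vk k @[k --> \oo] --> v -> legendre_argmax P f x v.
Proof.
move=> cP uf kmax xkx vkv.
have clP : closed P by exact: compact_closed.
have Pv : P v.
  apply: (closed_cvg P clP _ v vkv).
  by apply: nearW => k; exact: (kmax k).1.
split=> // w Pw; rewrite leNgt; apply/negP => vw.
(* Halfway between the value at [v] and the supposedly larger value at [w]. Semicontinuity keeps the
   values at [vk k] below [c], and replacing [x] by [xk k] changes the comparison with [w] only by
   the vanishing term [err0]. *)
pose c := ((dotv x v - f v) + (dotv x w - f w)) / 2.
have vc : dotv x v - f v < c by rewrite /c; lra.
have near_c : \forall k \near \oo, dotv x (vk k) - f (vk k) < c.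
  have := vkv _ (@usc_affine_sub P f x uf v Pv c vc).
  apply: (@filterS _ \oo) => k; apply; exact: (kmax k).1.
have err0 : dotv (xk k - x) (w - vk k) @[k --> \oo] --> (0 : R).
  have -> : 0 = dotv (x - x) (w - v) by rewrite subrr dotvC dotv0r.
  apply: cvg_dotv; apply: cvgB => //; exact: cvg_cst.
have near_err : \forall k \near \oo,
    c - (dotv x w - f w) < dotv (xk k - x) (w - vk k).
  by apply: (err0 [set r | _ < r]); apply: lt_nbhsr; rewrite subr_lt0 /c; lra.
have [k [kc ke]] := filter_ex (filterI near_c near_err).
have := (kmax k).2 w Pw; move: ke kc; rewrite dotvBl !dotvBr /c; lra.
Qed.

End Argmax.

(** * Danskin's theorem *)

Section Danskin.
Context {R : realType} {n : nat}.
Variables (P : set 'rV[R]_n) (f d : 'rV[R]_n -> R).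
Hypotheses (cP : compact P) (P0 : P !=set0).
(** [uf] is lower semicontinuity of [f], the regularity that [u0] has on all of [P] as a supremum of
    affine functions. *)
Hypotheses (uf : usc_on P (\- f)) (cd : {within P, continuous d}).

Let u (s : R) (y : 'rV[R]_n) := f y + s * d y.
Let psi (s : R) := legendre P (u s).

Lemma usc_onZ_continuous (a : R) : usc_on P (fun y => a * d y).
Proof.
by apply: continuous_usc_on => y; apply: cvgMr; exact: cd.
Qed.

Lemma usc_on_pencil s : usc_on P (\- u s).
Proof.
have := usc_onD uf (@usc_onZ_continuous (- s)).
by under eq_fun do rewrite mulNr -opprD.
Qed.

Lemma argmax_subdiff_sx s x v : legendre_argmax P (u s) x v ->
  subdiff_sx psi s x (- d v, v).
Proof.
move=> xv s' x'; rewrite /psi /= (legendre_argmaxE xv).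
have := legendre_argmax_ge x' cP P0 (@usc_on_pencil s') xv.1.
by rewrite /u dotvBr !(dotvC v); lra.
Qed.

Lemma subdiff_sx_convex s x : @convex_set R _ (subdiff_sx psi s x).
Proof.
apply/convex_setE => -[p1 p2] [q1 q2] t /andP[t0 t1] xp xq s' x'.
have := xp s' x'; have := xq s' x'; rewrite /= dotvDl !dotvZl.
rewrite -[t *: p1]/(t * p1) -[(1 - t) *: q1]/((1 - t) * q1).
move: (psi s x) (psi s' x') (dotv p2 _) (dotv q2 _) (s' - s) => a b g h r.
by nra.
Qed.

(** At a point of differentiability a maximizer is a subgradient, hence equals the gradient; the
    closed graph then handles limits of gradients. *)
Lemma reachable_argmax s x v : reachable_subgrad (psi s) x v ->
  legendre_argmax P (u s) x v.
Proof.
move=> [xk [dxk xkx gradv]].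
apply: (legendre_argmax_closed cP (@usc_on_pencil s) _ xkx gradv) => k.
have [w kw] := legendre_argmax_exists (xk k) cP P0 (@usc_on_pencil s).
rewrite (subdiff_grad (dxk k) (p := w))//.
exact: legendre_argmax_subdiff cP P0 (@usc_on_pencil s) kw.
Qed.

Lemma reachable_hull_subdiff_sx s x :
  conv_hull [set (- d v, v) | v in reachable_subgrad (psi s) x] `<=`
  subdiff_sx psi s x.
Proof.
apply: smallest_sub; first exact: subdiff_sx_convex.
by move=> _ [v /reachable_argmax xv <-]; exact: argmax_subdiff_sx.
Qed.

Lemma compact_argmax s x : compact (legendre_argmax P (u s) x).
Proof.
have [v0 xv0] := legendre_argmax_exists x cP P0 (@usc_on_pencil s).
have ux := @usc_affine_sub _ _ _ _ x (@usc_on_pencil s).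
have := compact_usc_superlevel (c := dotv x v0 - u s v0) cP ux.
congr compact; apply/seteqP; split=> v [Pv].
  by move=> v0v; split=> // w Pw; apply: le_trans v0v; exact: xv0.2.
by move=> vmax; split=> //; exact: vmax xv0.1.
Qed.

(* The maximizers of the perturbed problem [(s + t sigma, x + t xi)] all lie
   in the compact set [Q]; as [t] tends to 0, so does a maximizer of the
   unperturbed one. *)
Lemma danskin_direction s x p sigma xi : subdiff_sx psi s x p ->
  exists2 v, legendre_argmax P (u s) x v &
    sigma * p.1 + dotv xi p.2 <= sigma * - d v + dotv xi v.
Proof.
move=> xp; set lp := sigma * p.1 + _.
pose l v := sigma * - d v + dotv xi v.
have ul : usc_on P l.
  have := usc_onD (@usc_onZ_continuous (- sigma))
    (continuous_usc_on (continuous_subspaceT (@continuous_dotvr _ _ xi))).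
  by under eq_fun do rewrite mulNr -mulrN.
pose Q := [set v | P v /\ lp <= l v].
have cQ : compact Q by exact: compact_usc_superlevel.
pose g v := dotv x v - u s v.
(* Take a maximizer [v] of the perturbed problem. The subgradient inequality reads
   [psi s x + t lp <= g v + t l v], and [g v <= psi s x] then forces [lp <= l v]. *)
have pert t : 0 < t -> exists2 v, Q v & psi s x <= g v + t * (l v - lp).
  move=> t0; pose s' := s + t * sigma; pose x' := x + t *: xi.
  have [v xv] := legendre_argmax_exists x' cP P0 (@usc_on_pencil s').
  have vE : psi s' x' = g v + t * l v.
    rewrite /psi (legendre_argmaxE xv) /g /u /l /s' /x' dotvDl dotvZl; ring.
  have := xp s' x'; rewrite vE /s' /x' !(addrC s, addrC x) !addrK dotvZr => h.
  have {}h : psi s x + t * lp <= g v + t * l v.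
    by apply: le_trans h; rewrite /lp (dotvC xi); lra.
  have gv : g v <= psi s x.
    exact: legendre_argmax_ge cP P0 (@usc_on_pencil s) xv.1.
  exists v; last by lra.
  split; first exact: xv.1.
  by rewrite -(ler_pM2l t0); lra.
have Q0 : Q !=set0 by have [v Qv _] := pert 1 ltr01; exists v.
have QP : Q `<=` P by move=> v [].
(* [v] is the best point of [Q] for the unperturbed problem; [w] only serves to bound [l] on [Q]. *)
have [v Qv vmax] := compact_usc_max cQ Q0
  (usc_on_subset QP (@usc_affine_sub _ _ _ _ x (@usc_on_pencil s))).
have [w Qw wmax] := compact_usc_max cQ Q0 (usc_on_subset QP ul).
exists v; last exact: Qv.2.
have gv : psi s x <= g v.
  rewrite leNgt; apply/negP => gpsi.
  pose B := l w - lp; have B0 : 0 <= B by rewrite subr_ge0; exact: Qw.2.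
  (* Small enough that [t * B] stays below the gap [psi s x - g v], contrary to [pert]. *)
  pose t := (psi s x - g v) / (2 * (B + 1)).
  have tB : t * (2 * (B + 1)) = psi s x - g v by rewrite divfK// gt_eqF//; lra.
  have t0 : 0 < t by rewrite divr_gt0//; lra.
  have [z Qz] := pert t t0.
  have gz : g z <= g v by exact: vmax.
  have lz : l z <= l w by exact: wmax.
  have : t * (l z - lp) <= t * B by rewrite ler_pM2l// lerB.
  move: tB; rewrite mulrA; nra.
split; first exact: QP.
by move=> y Py; apply: le_trans gv; exact: legendre_argmax_ge (@usc_on_pencil s) Py.
Qed.

(** A subgradient outside the compact hull would be strictly separated from it by a linear form;
    [danskin_direction], applied to that form, yields a maximizer on the wrong side. *)
Lemma subdiff_sx_hull s x : subdiff_sx psi s x `<=`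
  conv_hull [set (- d v, v) | v in legendre_argmax P (u s) x].
Proof.
move=> p xp; set M := legendre_argmax P (u s) x; set K := image _ _.
(* Separation and compactness of hulls are stated for row vectors, so pairs are transported to
   ['rV_(1 + n)]. *)
pose L (q : R * 'rV[R]_n) : 'rV[R]_(1 + n) := row_mx q.1%:M q.2.
pose Linv (q : 'rV[R]_(1 + n)) : R * 'rV[R]_n := (lsubmx q 0 0, rsubmx q).
have LK q : Linv (L q) = q.
  by case: q => a b; rewrite /Linv /L /= row_mxKl row_mxKr mxE eqxx mulr1n.
have LKsub : conv_hull (L @` K) `<=` Linv @^-1` conv_hull K.
  apply: smallest_sub; last first.
    by move=> _ [q Kq <-]; rewrite /= LK; exact: sub_gen_smallest.
  apply/convex_setE => a b t t01 ha hb.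
  have -> : (Linv @^-1` conv_hull K) (t *: a + (1 - t) *: b) =
      conv_hull K (t *: Linv a + (1 - t) *: Linv b).
    congr (conv_hull K _); rewrite /Linv; congr pair.
      by rewrite !mxE.
    by apply/rowP => j; rewrite !mxE.
  exact: convex_conv_hull.
have cLK : compact (L @` K).
  rewrite /K image_comp.
  apply: continuous_compact; last exact: compact_argmax.
  have MP : M `<=` P by move=> v [].
  have cdM := continuous_subspaceW MP cd.
  move=> v; apply: cvg_mx => i j.
  case: (split_ordP j) => k ->.
  - rewrite /= row_mxEl; under eq_fun do rewrite row_mxEl mxE.
    rewrite mxE; apply: cvgMn; apply: cvgN; exact: cdM.
  - rewrite /= row_mxEr; under eq_fun do rewrite row_mxEr.
    exact: (continuous_subspaceT (@coord_continuous _ _ _ i k)).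
rewrite -(LK p); apply: LKsub; apply: contrapT => nLp.
have [v0 xv0] := legendre_argmax_exists x cP P0 (@usc_on_pencil s).
have K0 : conv_hull (L @` K) !=set0.
  exists (L (- d v0, v0)); apply: sub_gen_smallest; exists (- d v0, v0) => //.
  by exists v0.
have [l lsep] := compact_convex_separation (compact_conv_hull cLK)
  ((convex_setE _).2 (fun a b t => @convex_conv_hull _ _ _ a b t)) K0 nLp.
have lL q : dotv l (L q) = lsubmx l 0 0 * q.1 + dotv (rsubmx l) q.2.
  rewrite /dotv big_split_ord big_ord1; congr (_ + _).
    by rewrite row_mxEl !mxE eqxx mulr1n.
  by apply: eq_bigr => j _; rewrite row_mxEr [in RHS]mxE.
have [v xv vle] := danskin_direction (lsubmx l 0 0) (rsubmx l) xp.
have : dotv l (L (- d v, v)) < dotv l (L p).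
  by apply: lsep; apply: sub_gen_smallest; exists (- d v, v) => //; exists v.
by rewrite !lL ltNge vle.
Qed.

Lemma subdiff_sx_subdiff_hull s x : subdiff_sx psi s x `<=`
  conv_hull [set (- d v, v) | v in subdiff (psi s) x].
Proof.
apply: subset_trans (@subdiff_sx_hull s x) _.
apply: sub_smallest2r; first by apply/convex_setE => *; exact: convex_conv_hull.
apply: image_subset => v; exact: legendre_argmax_subdiff (@usc_on_pencil s).
Qed.

End Danskin.

(** * Polytopes are convex hulls of their vertices *)

Section Polytope.
Context {R : realType} {n d : nat}.
Variables (nu : 'I_d -> 'rV[int]_n) (lam : 'I_d -> R).
Local Notation P := (polytope nu lam).
Local Notation ell := (facet_fun nu lam).
Let slope k (h : 'rV[R]_n) := dotv h (map_mx intr (nu k)).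

Lemma facet_fun_line k y r h : ell k (y + r *: h) = ell k y + r * slope k h.
Proof. by rewrite /facet_fun dotvDl dotvZl addrAC. Qed.

(** Follow the ray until the first decreasing facet function vanishes, that is, up to the minimal
    ratio of value to rate of decrease. *)
Lemma polytope_line_exit y h : compact P -> P y -> h != 0 ->
  exists2 r, 0 <= r & P (y + r *: h) /\
    exists2 k, ell k (y + r *: h) = 0 & slope k h < 0.
Proof.
move=> cP Py h0.
have [k0 k0h] : exists k, slope k h < 0.
  apply: contrapT => /forallNP nslope.
  have Pr r : 0 <= r -> P (y + r *: h).
    move=> r0 k; rewrite facet_fun_line addr_ge0 ?Py// mulr_ge0// leNgt.
    exact/negP/nslope.
  have [M [_ Mbd]] := compact_bounded cP.
  have hn0 : 0 < `|h| by rewrite normr_gt0.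
  (* If no facet function decreased, the whole ray would lie in [P]; at this [r] its norm is at
     least [|M| + 1], beyond the bound. *)
  pose r := (`|M| + 1 + `|y|) / `|h|.
  have r0 : 0 <= r by rewrite divr_ge0// addr_ge0// addr_ge0.
  have rh : `|r *: h| = `|M| + 1 + `|y|.
    by rewrite normrZ ger0_norm// divfK// gt_eqF.
  have MM : M < `|M| + 1 / 2 by rewrite ltr_pwDr ?divr_gt0// ler_norm.
  have := Mbd _ MM _ (Pr r r0).
  by have := lerB_normD (r *: h) y; rewrite rh (addrC (r *: h)) => ? /=; lra.
have [k kh kmin] : exists2 k, slope k h < 0 &
    forall j, slope j h < 0 -> ell k y / - slope k h <= ell j y / - slope j h.
  by case: (@Order.TotalTheory.arg_minP _ _ _ k0 (fun j => slope j h < 0)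
    (fun j => ell j y / - slope j h) k0h) => k kh kmin; exists k.
pose r := ell k y / - slope k h.
have r0 : 0 <= r by rewrite divr_ge0 ?Py// oppr_ge0 ltW.
exists r => //; split.
  move=> j; rewrite facet_fun_line.
  have [jh|jh] := ltP (slope j h) 0; last first.
    by rewrite addr_ge0 ?Py// mulr_ge0.
  rewrite -[_ * _]opprK -mulrN subr_ge0 -ler_pdivlMr ?oppr_gt0//.
  exact: kmin.
exists k => //; rewrite facet_fun_line -[_ * _]opprK -mulrN divfK ?subrr//.
by rewrite oppr_eq0 lt_eqF.
Qed.

(* Induction on the number of inactive constraints: a point that is not a
   vertex lies on a segment of [P], whose prolongation in both directions
   hits new facets. *)
Lemma polytope_conv_vertices : compact P -> P `<=` conv_hull (vertex P).
Proof.
move=> cP y Py.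
have [m mE] := ubnP #|[set k | ell k y != 0]%SET|.
elim: m y Py mE => // m IH y Py; rewrite ltnS => ym.
have [|nvert] := pselect (vertex P y); first exact: sub_gen_smallest.
have [a [b [t [Pa Pb /andP[t0 t1] yE ab]]]] : exists a b t,
    [/\ P a, P b, 0 < t < 1, y = t *: a + (1 - t) *: b & a <> b].
  apply: contrapT => nex; apply: nvert; split=> // a b t Pa Pb t01 yE.
  by apply: contrapT => ab; apply: nex; exists a, b, t.
pose h := a - b.
have h0 : h != 0 by rewrite subr_eq0; exact/eqP.
(* [a] and [b] lie on opposite sides of [y] along [h], so a facet function vanishing at [y] and
   nonnegative at both is constant in that direction. *)
have active k : ell k y = 0 -> slope k h = 0.
  have aE : a = y + (1 - t) *: h.
    by rewrite yE /h; apply/rowP => j; rewrite !mxE; ring.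
  have bE : b = y + (- t) *: h.
    by rewrite yE /h; apply/rowP => j; rewrite !mxE; ring.
  have := Pa k; have := Pb k; rewrite aE bE !facet_fun_line => + + yk.
  rewrite yk !add0r mulNr oppr_ge0 pmulr_rle0// pmulr_rge0 ?subr_gt0//.
  by move=> le0 ge0; apply/eqP; rewrite eq_le le0.
(* An exit point keeps every active constraint and gains [k], which was inactive at [y] because its
   slope is nonzero. *)
have step r h' : (forall k, ell k y = 0 -> slope k h' = 0) ->
    P (y + r *: h') -> (exists2 k, ell k (y + r *: h') = 0 & slope k h' < 0) ->
    conv_hull (vertex P) (y + r *: h').
  move=> act Pr [k kr kh]; apply: IH => //; apply: leq_trans ym.
  apply/proper_card/properP; split.
    apply/fintype.subsetP => j; rewrite !inE; apply: contraNN => /eqP yj.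
    by rewrite facet_fun_line yj act// mulr0 addr0.
  exists k; rewrite !inE ?kr ?eqxx//.
  by apply/eqP => /act kh0; rewrite kh0 ltxx in kh.
have [r1 r10 [P1 k1]] := polytope_line_exit cP Py h0.
have hN0 : - h != 0 by rewrite oppr_eq0.
have [r2 r20 [P2 k2]] := polytope_line_exit cP Py hN0.
have h1 := step _ _ active P1 k1.
have h2 : conv_hull (vertex P) (y + r2 *: - h).
  apply: step => // k yk.
  by rewrite /slope dotvNl -/(slope k h) active// oppr0.
have r1gt0 : 0 < r1.
  rewrite lt_neqAle r10 andbT eq_sym; apply/eqP => r1E.
  move: k1; rewrite r1E scale0r addr0 => -[k /active ->].
  by rewrite ltxx.
have r12 : 0 < r1 + r2 by rewrite ltr_pwDl.
have -> : y = (r2 / (r1 + r2)) *: (y + r1 *: h) +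
              (1 - r2 / (r1 + r2)) *: (y + r2 *: - h).
  apply/rowP => j; rewrite !mxE; field.
  by rewrite gt_eqF.
apply: convex_conv_hull => //; apply/andP; split.
  by rewrite divr_ge0// ltW.
by rewrite ler_pdivrMr// mul1r lerDr.
Qed.

End Polytope.

(** * Convexity from the Hessian *)

Section Hessian.
Context {R : realType} {n : nat}.
Implicit Types (f : 'rV[R]_n -> R) (x h : 'rV[R]_n).

Lemma is_derive_line f x h t : differentiable f (x + t *: h) ->
  is_derive t 1 (fun r : R => f (x + r *: h)) ('D_h f (x + t *: h)).
Proof.
move=> /(@diff_derivable _ _ _ _ _ h) df.
have E : (fun r : R => r^-1 *: (((fun r : R => f (x + r *: h)) \o shift t) (r *: 1)
           - f (x + t *: h))) =
         (fun r : R => r^-1 *: ((f \o shift (x + t *: h)) (r *: h)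
           - f (x + t *: h))).
  apply/funext => r; congr (_ *: (f _ - _)); rewrite /= -[r *: 1]/(r * 1) mulr1.
  by rewrite scalerDl addrCA.
by apply: DeriveDef; rewrite /derivable /derive E.
Qed.

Lemma derive_rowE f x h : differentiable f x ->
  'D_h f x = \sum_j h 0 j * 'D_(delta_mx 0 j) f x.
Proof.
move=> df; rewrite deriveE// {1}(row_sum_delta h) linear_sum.
by apply: eq_bigr => j _; rewrite linearZ deriveE.
Qed.

Lemma derive2_hessian f x h : smooth_on setT f ->
  'D_h ('D_h f) x = (h *m hessian f x *m h^T) 0 0.
Proof.
move=> sf.
have df z : differentiable f z by exact: (sf 1%N).1.
have dDf v z : differentiable ('D_v f) z by exact: ((sf 2%N).2 v).1.
have DhE : 'D_h f = \sum_j h 0 j *: 'D_(delta_mx 0 j) f.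
  apply/funext => z; rewrite derive_rowE// fct_sumE.
  by apply: eq_bigr.
rewrite derive_rowE// mxE.
under [RHS]eq_bigr do rewrite !mxE mulr_suml.
rewrite [RHS]exchange_big; apply: eq_bigr => i _ /=.
rewrite DhE derive_sum => [|j]; last exact/derivableZ/diff_derivable.
rewrite mulr_sumr; apply: eq_bigr => j _.
rewrite deriveZ; last exact: diff_derivable.
by rewrite mxE -mulrA [_ *: _]mulrC.
Qed.

(** By the mean value theorem the increments of [g] over [0, 1] and [-1, 0] are [k c1] and [k c2]
    with [c2 < 0 < c1]; a third application, to [k], compares them through the positive second
    derivative. *)
Lemma posdef_midpoint f x h : smooth_on setT f ->
  (forall z, posdef (hessian f z)) -> 2 * f x <= f (x + h) + f (x - h).
Proof.
move=> sf pf; have [->|h0] := eqVneq h 0; first by rewrite subr0 addr0; lra.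
pose g (t : R) := f (x + t *: h); pose k (t : R) : R := 'D_h f (x + t *: h).
have dg (t : R) : is_derive t 1 g (k t) by apply: is_derive_line; exact: (sf 1%N).1.
have dk (t : R) : is_derive t 1 k ('D_h ('D_h f) (x + t *: h)).
  by apply: is_derive_line; exact: ((sf 2%N).2 h).1.
have cont (q dq : R -> R) : (forall t : R, is_derive t 1 q (dq t)) -> continuous q.
  move=> dq' t; apply/differentiable_continuous/derivable1_diffP.
  exact: (@ex_derive _ _ _ _ _ _ _ (dq' t)).
have mvt (q dq : R -> R) a b : a < b -> (forall t : R, is_derive t 1 q (dq t)) ->
    exists2 c, c \in `]a, b[%R & q b - q a = dq c * (b - a).
  move=> ab dq'; apply: MVT => //; exact/continuous_subspaceT/cont.
have [c1 c1I g1] := mvt _ _ 0 1 ltr01 dg.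
have [c2 c2I g2] := mvt _ _ (- 1) 0 (ltrN10 _) dg.
move: c1I c2I; rewrite !in_itv /= => /andP[c1l _] /andP[_ c2r].
have [c _ k12] := mvt _ _ c2 c1 (lt_trans c2r c1l) dk.
have kpos : 0 < k c1 - k c2.
  rewrite k12 mulr_gt0//; last by rewrite subr_gt0 (lt_trans c2r).
  by rewrite derive2_hessian//; exact: pf.
have g0 : g 0 = f x by rewrite /g scale0r addr0.
have g1E : g 1 = f (x + h) by rewrite /g scale1r.
have gN1 : g (- 1) = f (x - h) by rewrite /g scaleN1r.
by move: g1 g2; rewrite g0 g1E gN1; lra.
Qed.

End Hessian.

(** * Finiteness of the dual potential on the polytope *)

Section Toric.
Context {R : realType} {n d : nat}.
Variables (nu : 'I_d -> 'rV[int]_n) (lam : 'I_d -> R).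
Local Notation P := (polytope nu lam).

(** [w] is the sum of the normals at the vertex and pairs to 1 with each dual basis vector, so
    moving by [t *: w] multiplies every [|z_j|^2] by [expR t]. As [t] tends to minus infinity the
    ray reaches the origin of the chart. *)
Lemma in_chart_scale (sigma : 'I_n -> 'I_d) (x : 'rV[R]_n) :
  normals_mx nu sigma \in unitmx ->
  exists (w : 'rV[R]_n) (a : 'rV[R]_n),
    forall t, in_chart nu sigma (x + t *: w) (expR (t / 2) *: (a, 0)).
Proof.
move=> uN; set N := normals_mx nu sigma in uN.
pose Winv : 'M[R]_n := map_mx intr (invmx N).
pose w : 'rV[R]_n := const_mx 1 *m map_mx intr N.
have wW : w *m Winv = const_mx 1.
  by rewrite /w /Winv -mulmxA -map_mxM mulmxV// map_mx1 mulmx1.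
exists w, (\row_j expR ((x *m Winv) 0 j / 2)) => t j.
have -> : (x + t *: w) *m map_mx intr (invmx (normals_mx nu sigma)) =
    x *m Winv + t *: const_mx 1 by rewrite mulmxDl -scalemxAl wW.
move: (x *m Winv) => q.
rewrite /= scaler0 !mxE expr0n addr0 mulr1 -expRD expr2 -expRD; congr expR.
by lra.
Qed.

(* Along the ray of the open orbit converging to the fixed point [p], the
   function [psi - <p, .>] is midpoint convex and converges to [phi 0], so it
   is bounded below independently of the starting point. *)
Lemma vertex_potential_bound psi p : delzant nu lam ->
  toric_kaehler_potential nu lam psi ->
  (forall x h, 2 * psi x <= psi (x + h) + psi (x - h)) ->
  vertex P p -> exists C, forall x, dotv p x - psi x <= C.
Proof.
move=> dP kpsi mid Pp.
have [sigma sigmap uN] := delzant_vertex dP Pp.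
have [phi [sphi _ psiE]] := kpsi p sigma Pp sigmap.
have /(_ 0 I) phic := sphi 0%N.
have /nbhs_normP[r /= r0 rphi] :
    nbhs (0 : 'rV[R]_n * 'rV[R]_n) [set z | `|phi 0 - phi z| < 1].
  have /cvgrPdist_lt/(_ 1 ltr01) := phic; exact.
(* Midpoint convexity at [x], [x + t w], [x + 2 t w] bounds [psi x - dotv p x] below by
   [2 phi (del z0) - phi (del^2 z0)], and both values of [phi] are within 1 of [phi 0]. *)
exists (3 - phi 0) => x.
have [w [a chart]] := in_chart_scale x uN.
pose z0 : 'rV[R]_n * 'rV[R]_n := (a, 0).
(* [del <= 1] and [del * |z0| < r], so [del *: z0] and [del ^+ 2 *: z0] both lie in the ball of
   radius [r]. *)
pose del := r / (r + `|z0|).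
have rz : 0 < r + `|z0| by rewrite ltr_pwDl.
have del0 : 0 < del by rewrite divr_gt0.
have del1 : del <= 1 by rewrite ler_pdivrMr// mul1r lerDl.
have delz : del * `|z0| < r.
  by rewrite mulrAC ltr_pdivrMr// mulrDr ltrDr mulr_gt0.
pose t := 2 * ln del.
have et : expR (t / 2) = del by rewrite /t mulrC mulKf// lnK.
have e2t : expR ((t + t) / 2) = del ^+ 2 by rewrite mulrDl expRD et expr2.
have small q : 0 <= q <= del -> `|phi 0 - phi (q *: z0)| < 1.
  move=> /andP[q0 qd]; apply: rphi; rewrite /= sub0r normrN normrZ ger0_norm//.
  by apply: le_lt_trans delz; rewrite ler_wpM2r.
have h1 := psiE _ _ (chart t); have h2 := psiE _ _ (chart (t + t)).
rewrite et in h1; rewrite e2t in h2.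
have s1 := small del; rewrite lexx (ltW del0) in s1.
have {}s1 := s1 isT.
have s2 : `|phi 0 - phi (del ^+ 2 *: z0)| < 1.
  by apply: small; rewrite sqr_ge0/= expr2 ger_pMr.
have := mid (x + t *: w) (t *: w).
rewrite addrK -addrA -scalerDl h1 h2 !dotvDr !dotvZr.
move: s1 s2; rewrite !ltr_norml => /andP[s1 s1'] /andP[s2 s2'].
by lra.
Qed.

(** The slopes [y] admitting such a bound form a convex set, which contains the vertices. *)
Lemma polytope_potential_bound psi y : delzant nu lam ->
  toric_kaehler_potential nu lam psi ->
  (forall x h, 2 * psi x <= psi (x + h) + psi (x - h)) ->
  P y -> exists C, forall x, dotv y x - psi x <= C.
Proof.
move=> dP kpsi mid /(polytope_conv_vertices (delzant_compact dP)).
apply: (@smallest_sub _ _ _ [set y | exists C, forall x, dotv y x - psi x <= C]).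
  apply/convex_setE => a b t /andP[t0 t1] [Ca ha] [Cb hb].
  exists (t * Ca + (1 - t) * Cb) => x; rewrite dotvDl !dotvZl.
  have := ler_wpM2l t0 (ha x).
  have t1' : 0 <= 1 - t by rewrite subr_ge0.
  have := ler_wpM2l t1' (hb x).
  by lra.
by move=> p Pp; exact: vertex_potential_bound.
Qed.

End Toric.

(** * Semicontinuity of the dual potential and conclusion *)

Lemma legendre_lsc {R : realType} {n : nat} (P : set 'rV[R]_n) psi :
  (forall y, P y -> exists C, forall x, dotv y x - psi x <= C) ->
  usc_on P (\- legendre setT psi).
Proof.
move=> bdd v Pv c vc; have {}vc : - c < legendre setT psi v by rewrite ltrNl.
(* A single affine function [w |-> dotv w z - psi z] already exceeds [- c] at [v], hence near [v];
   the bound [bdd] makes it a lower bound of the real supremum at each [w] in [P]. *)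
have [|_ [z _ <-] cz] := sup_gt _ vc; first by exists (dotv v 0 - psi 0), 0.
have nearz : \forall w \near v, - c < dotv z w - psi z.
  have zc : - c + psi z < dotv z v by rewrite dotvC; lra.
  have := @continuous_dotvr _ _ z v _ (lt_nbhsr zc).
  by apply: (@filterS _ (nbhs v)) => w /=; rewrite ltrBrDr.
apply: (@filterS _ (nbhs v)) nearz => w zw Pw; rewrite ltrNl.
apply: lt_le_trans zw _; rewrite (dotvC z).
apply: ub_le_sup; last by exists z.
by have [C hC] := bdd w Pw; exists C => _ [x _ <-].
Qed.

Lemma smooth_upto_continuous {R : realType} {V W : normedModType R} (P : set V)
  (f : V -> W) : smooth_upto P f -> {within P, continuous f}.
Proof.
move=> [U [F [_ PU sF Ff]]].
apply: (@subspace_eq_continuous _ _ _ F).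
  by move=> x /set_mem; exact: Ff.
apply: continuous_in_subspaceT => x /set_mem Px.
exact: (sF 0%N _ (PU _ Px)).
Qed.

Unset Implicit Arguments.
Theorem lemma1 (R : realType) (n d : nat)
    (nu : 'I_d -> 'rV[int]_n) (lam : 'I_d -> R)
    (psi0 dpsi0 du0 : 'rV[R]_n -> R)
    (data : toric_cauchy_data nu lam psi0 dpsi0 du0) :
  let P := polytope nu lam in
  let u0 := legendre setT psi0 in
  let u := fun (s : R) (y : 'rV[R]_n) => u0 y + s * du0 y in
  let psi := fun (s : R) => legendre P (u s) in
  let A := fun (s : R) => [set y | P y /\ u s y <> biconjugate P (u s) y] in
  forall (s : R) (y : 'rV[R]_n),
    0 < s -> (A s `\` boundary P) y ->
    let x := grad (biconjugate P (u s)) y in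
    conv_hull [set (- du0 v, v) | v in reachable_subgrad (psi s) x]
      `<=` subdiff_sx psi s x
    /\
    subdiff_sx psi s x
      `<=` conv_hull [set (- du0 v, v) | v in subdiff (psi s) x].
Proof.
move=> P u0 u psi A s y _ _ x.
have dP := tcd_delzant data.
have cP : compact P := delzant_compact dP.
have P0 : P !=set0 by have [z /interior_subset Pz] := delzant_full dP; exists z.
have mid z h : 2 * psi0 z <= psi0 (z + h) + psi0 (z - h).
  exact: posdef_midpoint (tcd_smooth data) (tcd_hessian data).
(* Finiteness of the supremum at every point of [P], boundary included, is where the Kaehler class
   enters. *)
have lsc : usc_on P (\- u0).
  apply: legendre_lsc => z; exact: polytope_potential_bound (tcd_kaehler data) mid.
have du0c := smooth_upto_continuous (tcd_du0_smooth data).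
split; first exact: reachable_hull_subdiff_sx.
exact: subdiff_sx_subdiff_hull.
Qed.
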